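(* Let $\mathcal{R}=\mathbb{F}_{q_1}\oplus\cdots\oplus\mathbb{F}_{q_r}$ with $r\ge1$, and let $k\ge1$. There exists a sequence $\mathbf{a}$ over $\mathcal{R}$ satisfying a linear recurrence of degree $k$ over $\mathcal{R}$ (with $c_0$ a unit) with $\rho(\mathbf{a})=|\mathcal{R}|^k-1$ if and only if $r=1$, i.e. $\mathcal{R}$ is a field.
   Context: $q_1,\dots,q_r$ are prime powers (not necessarily of the same characteristic), so $|\mathcal{R}|=q_1\cdots q_r$. A sequence $(a_n)_{n\ge0}$ over $\mathcal{R}$ satisfies a linear recurrence of degree $k$ if there are $c_0,\dots,c_{k-1}\in\mathcal{R}$ with $c_0$ a unit such that $a_{n+k}=\sum_{i=0}^{k-1}c_ia_{n+i}$ for all $n\ge0$; such sequences are purely periodic, and $\rho(\mathbf{a})$ is the least $m>0$ with $a_{n+m}=a_n$ for all $n\ge0$. *)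

(* Defs.v *)
From HB Require Import structures.
From mathcomp Require Import all_boot all_order all_algebra all_fingroup all_field.
Set Implicit Arguments. Unset Strict Implicit. Unset Printing Implicit Defensive.
Import GRing.Theory.
Local Open Scope ring_scope.

Definition PRing (r : nat) (F : 'I_r -> finFieldType) : finType :=
  {dffun forall i : 'I_r, F i}.

Section PRingOps.
Variables (r : nat) (F : 'I_r -> finFieldType).
Definition pzero : PRing F := [ffun i => (0 : F i)].
Definition pone  : PRing F := [ffun i => (1 : F i)].
Definition padd (x y : PRing F) : PRing F := [ffun i => x i + y i].
Definition pmul (x y : PRing F) : PRing F := [ffun i => x i * y i].
Definition punit (x : PRing F) : Prop := exists y : PRing F, pmul x y = pone.

Definition lin_rec (k : nat) (c : nat -> PRing F) (a : nat -> PRing F) : Prop :=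
  punit (c 0%N) /\
  forall n : nat, a (n + k)%N = \big[padd/pzero]_(i < k) pmul (c i) (a (n + i)%N).

Definition satisfies_lrec_deg (k : nat) (a : nat -> PRing F) : Prop :=
  exists c : nat -> PRing F, lin_rec k c a.

Definition is_period (a : nat -> PRing F) (m : nat) : Prop :=
  forall n : nat, a (n + m)%N = a n.
Definition least_period (a : nat -> PRing F) (m : nat) : Prop :=
  (0 < m)%N /\ is_period a m /\ forall m', (0 < m')%N -> is_period a m' -> (m <= m')%N.
End PRingOps.

(* Main.v *)
(* Over a field F_q, take a generator z of the cyclic group F_(q^k)^* and a nonzero
   F_q-linear form phi on F_(q^k).  Then a_n = phi (z^n) satisfies the recurrence given
   by the minimal polynomial of z, which has degree k, and its periods are exactly the
   multiples of the order q^k - 1 of z: a period m with z^m <> 1 would make phi vanish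
   on (z^m - 1) F_(q^k)^*, i.e. everywhere.

   Conversely, a sequence of least period N has N pairwise distinct windows
   (a_n, ..., a_(n+k-1)), 0 <= n < N.  Over R = F_(q_1) (+) ... (+) F_(q_r) the recurrence
   acts componentwise, so whether a window vanishes in the i-th component is the same
   along the whole orbit.  For r >= 2 the constant windows 0, e_1, e_2 have pairwise
   different vanishing patterns, hence at most one of them occurs and N <= |R|^k - 2. *)

Require Import Defs.
From HB Require Import structures.
From mathcomp Require Import all_boot all_order all_algebra all_fingroup all_field.
From mathcomp Require Import all_solvable zify.
Set Implicit Arguments. Unset Strict Implicit. Unset Printing Implicit Defensive.
Import GRing.Theory.
Local Open Scope ring_scope.

Lemma finField_card_natr (F : finFieldType) : #|F|%:R = 0 :> F.
Proof.
have [p _ pcharFp] := finPcharP F.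
rewrite (card_pprimeChar pcharFp) natrX (pcharf0 pcharFp) expr0n.
case: eqP => // n0; have := finNzRing_gt1 F.
by rewrite (card_pprimeChar pcharFp) n0.
Qed.

Lemma finField_ext_exists (F : finFieldType) k : (0 < k)%N ->
  {L : splittingFieldType F | #|FinFieldExtType L| = (#|F| ^ k)%N}.
Proof.
(* L is the splitting field of 'X^m - 'X, whose m distinct roots form the subfield
   fixed by the k-th power of the Frobenius automorphism, hence all of L. *)
move=> k_gt0; pose m := (#|F| ^ k)%N.
have m_gt1: (m > 1)%N by rewrite (ltn_exp2l 0) ?finNzRing_gt1.
have m_gt0 := ltnW m_gt1; have m1_gt0: (m.-1 > 0)%N by rewrite -ltnS prednK.
pose q := 'X^m - 'X; have Dq R: q R = ('X^(m.-1) - 1) * ('X - 0).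
  by rewrite subr0 mulrBl mul1r -exprSr prednK.
have /FinSplittingFieldFor[/= L splitLq]: q F != 0.
  by rewrite Dq monic_neq0 ?rpredM ?monicXsubC ?monicXnsubC.
rewrite rmorphB rmorphXn /= map_polyX -/(q L) in splitLq.
exists L.
have /finField_galois_generator[/= a _ Da]: (1 <= {:L})%VS by apply: sub1v.
pose Em := fixedSpace (a ^+ k)%g; rewrite dimv1 expn1 in Da.
have{splitLq} [zs DqL defL] := splitLq.
have mL0 : (m%:R : L) = 0.
  by rewrite /m natrX -(rmorph_nat (in_alg L)) finField_card_natr rmorph0 expr0n gtn_eqF.
have Uzs: uniq zs.
  rewrite -separable_prod_XsubC -(eqp_separable DqL) Dq separable_root andbC.
  rewrite /root !hornerE subr_eq0 eq_sym expr0n gtn_eqF ?oner_eq0 //=.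
  rewrite cyclotomic.separable_Xn_sub_1 // -subn1 natrB // subr_eq0.
  by rewrite mL0 eq_sym oner_eq0.
suffices /eq_card->: FinFieldExtType L =i zs.
  apply: succn_inj; rewrite (card_uniqP _) //= -(size_prod_XsubC _ id).
  by rewrite -(eqp_size DqL) size_polyDl size_polyXn // size_polyN size_polyX.
have in_zs: zs =i Em.
  move=> z; rewrite -root_prod_XsubC -(eqp_root DqL) (sameP fixedSpaceP eqP).
  rewrite /root !hornerE subr_eq0 /= /m; congr (_ == z).
  elim: (k) => [|i IHi]; first by rewrite gal_id.
  by rewrite expgSr expnSr exprM IHi galM ?Da ?memvf.
suffices defEm: Em = {:L}%VS by move=> z; rewrite in_zs defEm memvf.
apply/eqP; rewrite eqEsubv subvf -defL -[Em]subfield_closed agenvS //.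
by rewrite subv_add sub1v; apply/span_subvP=> z; rewrite in_zs.
Qed.

Lemma finField_ext_dim (F : finFieldType) (L : fieldExtType F) k :
  #|FinFieldExtType L| = (#|F| ^ k)%N -> \dim {:L} = k.
Proof.
move=> cardL; have := card_vspace (fullv : {vspace finvect_type L}).
have -> : #|(fullv : {vspace finvect_type L})| = #|FinFieldExtType L|.
  by apply: eq_card => v; rewrite memvf.
by rewrite cardL => /eqP; rewrite eqn_exp2l ?finNzRing_gt1 // => /eqP.
Qed.

Lemma expf_card_pred (F : finFieldType) (x : F) : x != 0 -> x ^+ #|F|.-1 = 1.
Proof.
move=> x_nz; apply: (mulIf x_nz); rewrite mul1r -exprSr prednK ?expf_card //.
exact: ltnW (finNzRing_gt1 F).
Qed.

Lemma finField_prim_root_exists (F : finFieldType) :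
  exists z : F, (#|F|.-1).-primitive_root z.
Proof.
pose rs := enum (predC1 (0 : F)).
have n_gt0 : (0 < #|F|.-1)%N by rewrite -ltnS prednK ?finNzRing_gt1 // ltnW ?finNzRing_gt1.
have rs_unity : all (#|F|.-1).-unity_root rs.
  by apply/allP => x; rewrite mem_enum unity_rootE => /expf_card_pred ->.
have size_rs : size rs = #|F|.-1 by rewrite -cardE cardC1.
have [z _ prim_z] := hasP (has_prim_root n_gt0 rs_unity (enum_uniq _) (eq_leq (esym size_rs))).
by exists z.
Qed.

Lemma minPoly_recurrence (K : fieldType) (L : fieldExtType K) (z : L) :
  z != 0 -> exists2 c : nat -> K, c 0%N != 0 &
    z ^+ adjoin_degree 1 z = \sum_(i < adjoin_degree 1 z) c i *: z ^+ i.
Proof.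
move=> z_nz; set d := adjoin_degree 1 z; pose p := minPoly 1 z.
have p_scalar j : exists e : K, p`_j == e *: 1.
  have : p`_j \in (1%VS : {vspace L}) by apply/polyOverP/minPolyOver.
  by case/vlineP => e ->; exists e.
pose c j := - xchoose (p_scalar j).
have pE j : p`_j = - c j *: 1 by rewrite opprK; apply/eqP/(xchooseP (p_scalar j)).
have size_p : size p = d.+1 by rewrite size_minPoly.
exists c.
  apply: contra z_nz => /eqP c0.
  have X_dvd_p : 'X - 0%:P %| p by rewrite dvdp_XsubCl /root horner_coef0 pE c0 oppr0 scale0r.
  have X_over : 'X - 0%:P \is a polyOver (1%AS : {subfield L}).
    by rewrite polyOverXsubC mem0v.
  have := minPoly_irr X_over X_dvd_p.
  rewrite polyXsubC_eqp1 orbF => /eqp_root/(_ z).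
  by rewrite root_minPoly root_XsubC.
have := minPolyxx 1 z; rewrite -/p horner_coef size_p big_ord_recr /=.
have -> : p`_d = 1 by have /monicP := monic_minPoly 1 z; rewrite /lead_coef size_p.
rewrite mul1r addrC => /eqP; rewrite addr_eq0 => /eqP ->.
rewrite -sumrN; apply: eq_bigr => i _.
by rewrite pE mulr_algl scaleNr opprK.
Qed.

Lemma scalar_exp_period (K : fieldType) (L : fieldExtType K) (phi : {scalar L})
    (x z : L) m :
  phi x != 0 -> (forall y, y != 0 -> exists e, y = z ^+ e) ->
  (forall e, phi (z ^+ (e + m)) = phi (z ^+ e)) -> z ^+ m = 1.
Proof.
move=> phi_x z_gen z_period; apply/eqP; apply: contraNT phi_x => zm_neq1.
have zm1_nz : z ^+ m - 1 != 0 by rewrite subr_eq0.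
have [-> | x_nz] := eqVneq x 0; first by rewrite linear0.
have [e ze] : exists e, (z ^+ m - 1)^-1 * x = z ^+ e.
  by apply: z_gen; rewrite mulf_neq0 ?invr_eq0.
have -> : x = (z ^+ m - 1) * z ^+ e by rewrite -ze mulrA divff ?mul1r.
by rewrite mulrBl mul1r -exprD addnC linearB /= z_period subrr.
Qed.

Lemma finField_rec_period_exists (K : finFieldType) k : (0 < k)%N ->
  exists b c : nat -> K, [/\ c 0%N != 0,
    forall n, b (n + k)%N = \sum_(i < k) c i * b (n + i)%N &
    forall m, (forall n, b (n + m)%N = b n) <-> (#|K| ^ k - 1 %| m)%N].
Proof.
move=> k_gt0; have [L cardL] := finField_ext_exists K k_gt0.
have [z prim_z] := finField_prim_root_exists (FinFieldExtType L).
rewrite cardL -subn1 in prim_z.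
have z_gen (y : L) : y != 0 -> exists e, y = z ^+ e.
  move=> y_nz; have := expf_card_pred (y_nz : y != 0 :> FinFieldExtType L).
  by rewrite cardL -subn1 => /(prim_rootP prim_z)[e ->]; exists e.
have z_nz : z != 0.
  by rewrite (prim_root_eq0 prim_z) subn_eq0 -ltnNge (ltn_exp2l 0) ?finNzRing_gt1.
have z_deg : adjoin_degree 1 z = k.
  suff adj_full : <<1; z>>%VS = fullv.
    by rewrite adjoin_degreeE adj_full dimv1 divn1 (finField_ext_dim cardL).
  apply/eqP; rewrite eqEsubv subvf; apply/subvP => y _.
  have [-> | /z_gen[e ->]] := eqVneq y 0; first exact: mem0v.
  by rewrite rpredX // memv_adjoin.
have [c c0 z_rec] := minPoly_recurrence z_nz; rewrite z_deg in z_rec.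
pose X := vbasis (fullv : {vspace L}).
have dim_gt0 : (0 < \dim (fullv : {vspace L}))%N by rewrite (finField_ext_dim cardL).
pose i0 := Ordinal dim_gt0.
have coord_X : coord X i0 X`_i0 != 0.
  by rewrite coord_free ?eqxx ?oner_eq0 // (basis_free (vbasisP fullv)).
exists (fun n => coord X i0 (z ^+ n)), c; split => // [n | m].
  rewrite exprD z_rec mulr_sumr linear_sum; apply: eq_bigr => i _.
  by rewrite -scalerAr linearZ exprD.
rewrite (prim_order_dvd prim_z); split => [z_period | /eqP zm1 n].
  by apply/eqP; apply: (scalar_exp_period coord_X z_gen z_period).
by rewrite exprD zm1 mulr1.
Qed.

Lemma card_codom_le_subn2 (T : finType) N (f : 'I_N -> T) (x y : T) :
  injective f -> x != y -> x \notin codom f -> y \notin codom f -> (N <= #|T| - 2)%N.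
Proof.
move=> f_inj xy fx fy.
have sub : codom f \subset ~: [set x; y].
  apply/subsetP => s fs; rewrite inE in_set2.
  by apply/negP => /orP[] /eqP s_eq; move: fs; rewrite s_eq ?(negbTE fx) ?(negbTE fy).
have := subset_leq_card sub; rewrite card_codom // card_ord.
have := cardsC [set x; y]; rewrite cards2 xy.
lia.
Qed.

Lemma padd_bigE r (F : 'I_r -> finFieldType) I (P : pred I) (idx : seq I)
    (f : I -> PRing F) (i : 'I_r) :
  (\big[padd (F:=F)/pzero F]_(j <- idx | P j) f j) i = \sum_(j <- idx | P j) f j i.
Proof.
by apply: (big_morph (fun x : PRing F => x i)) => [x y|]; rewrite /padd /pzero ffunE.
Qed.

Section Windows.
Variables (r : nat) (F : 'I_r -> finFieldType) (k : nat) (c : nat -> PRing F).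
Implicit Types (a : nat -> PRing F) (s : {ffun 'I_k -> PRing F}).

Definition window a n : {ffun 'I_k -> PRing F} := [ffun j : 'I_k => a (n + j)%N].

Lemma window_succE a n (j : 'I_k) : lin_rec k c a ->
  window a n.+1 j = if insub j.+1 is Some j' then window a n j'
                    else \big[padd (F:=F)/pzero F]_(i < k) pmul (c i) (window a n i).
Proof.
move=> [_ a_rec]; rewrite ffunE addSnnS; case: insubP => [j' _ <- | ]; first by rewrite ffunE.
rewrite -leqNgt => k_le; have -> : j.+1 = k by apply/eqP; rewrite eqn_leq ltn_ord k_le.
by rewrite a_rec; apply: eq_bigr => i _; rewrite ffunE.
Qed.

Lemma window_succ_eq a b n m : lin_rec k c a -> lin_rec k c b ->
  window a n = window b m -> window a n.+1 = window b m.+1.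
Proof. by move=> a_rec b_rec ab; apply/ffunP => j; rewrite !window_succE // ab. Qed.

Lemma window_addn_eq a b n m t : lin_rec k c a -> lin_rec k c b ->
  window a n = window b m -> window a (n + t) = window b (m + t).
Proof.
move=> a_rec b_rec ab; elim: t => [|t IHt]; first by rewrite !addn0.
by rewrite !addnS; apply: window_succ_eq.
Qed.

Lemma is_period_addMn a N : is_period a N -> forall t n, a (n + t * N)%N = a n.
Proof. by move=> a_per; elim=> [|t IHt] n; rewrite ?addn0 // mulSnr addnA a_per. Qed.

Lemma is_period_window_eq a N i j : (0 < k)%N -> (0 < N)%N -> lin_rec k c a ->
  is_period a N -> (i <= j)%N -> window a i = window a j -> is_period a (j - i).
Proof.
move=> k_gt0 N_gt0 a_rec a_per le_ij a_ij n.
have shift t : a (i + t)%N = a (j + t)%N.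
  move/ffunP/(_ (Ordinal k_gt0)): (window_addn_eq t a_rec a_rec a_ij).
  by rewrite !ffunE !addn0.
rewrite -(is_period_addMn a_per i) -[in RHS](is_period_addMn a_per i).
have -> : (n + (j - i) + i * N = j + (n + i * N - i))%N by nia.
by rewrite -shift; congr a; nia.
Qed.

Lemma least_period_window_inj a N : (0 < k)%N -> lin_rec k c a -> least_period a N ->
  injective (fun t : 'I_N => window a t).
Proof.
move=> k_gt0 a_rec [N_gt0 [a_per a_min]].
have window_neq (t1 t2 : 'I_N) : (t1 < t2)%N -> window a t1 != window a t2.
  move=> lt12; apply/eqP => /(is_period_window_eq k_gt0 N_gt0 a_rec a_per (ltnW lt12)).
  have d_gt0 : (0 < t2 - t1)%N by rewrite subn_gt0.
  by move/(a_min _ d_gt0); have := ltn_ord t2; lia.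
move=> t1 t2 eq12; apply: val_inj; case: (ltngtP t1 t2) => // lt12.
  by move: (window_neq _ _ lt12); rewrite eq12 eqxx.
by move: (window_neq _ _ lt12); rewrite eq12 eqxx.
Qed.

Definition vanishes_at (i : 'I_r) s := [forall j, s j i == 0].

Lemma vanishes_at_succ a n i : lin_rec k c a ->
  vanishes_at i (window a n) -> vanishes_at i (window a n.+1).
Proof.
move=> a_rec /forallP a_van; apply/forallP => j; rewrite window_succE //.
case: insubP => [j' _ _ | _]; first exact: a_van.
rewrite padd_bigE big1 // => l _; rewrite ffunE.
by move/eqP: (a_van l) => ->; rewrite mulr0.
Qed.

Lemma vanishes_at_window a N n i : lin_rec k c a -> (0 < N)%N -> is_period a N ->
  vanishes_at i (window a n) = vanishes_at i (window a 0).
Proof.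
move=> a_rec N_gt0 a_per.
have van_addn m t : vanishes_at i (window a m) -> vanishes_at i (window a (m + t)).
  by move=> a_van; elim: t => [|t IHt]; rewrite ?addn0 // addnS vanishes_at_succ.
apply/idP/idP => [/(van_addn _ (n * N - n)%N) | /(van_addn _ n)] //.
have -> : (n + (n * N - n) = 0 + n * N)%N by nia.
suff -> : window a (0 + n * N) = window a 0 by [].
by apply/ffunP => j; rewrite !ffunE addnAC is_period_addMn.
Qed.

End Windows.

Lemma lin_rec_least_period_le r (F : 'I_r -> finFieldType) k (c a : nat -> PRing F) N :
  (1 < r)%N -> (0 < k)%N -> lin_rec k c a -> least_period a N ->
  (N <= #|PRing F| ^ k - 2)%N.
Proof.
move=> r_gt1 k_gt0 a_rec a_least; have [N_gt0 [a_per _]] := a_least.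
pose f (t : 'I_N) := window k a t.
have f_inj : injective f := least_period_window_inj k_gt0 a_rec a_least.
have card_windows : #|{ffun 'I_k -> PRing F}| = (#|PRing F| ^ k)%N.
  by rewrite card_ffun card_ord.
pose cw (x : PRing F) : {ffun 'I_k -> PRing F} := [ffun _ => x].
have van_cw i x : vanishes_at i (cw x) = (x i == 0).
  apply/forallP/idP => [/(_ (Ordinal k_gt0)) | x_i j]; by rewrite ffunE.
have out_of_codom x y i :
  vanishes_at i x != vanishes_at i y -> (x \notin codom f) || (y \notin codom f).
  apply: contraR; rewrite negb_or !negbK => /andP[/codomP[t1 ->] /codomP[t2 ->]].
  by rewrite /f !(vanishes_at_window _ i a_rec N_gt0 a_per).
have neq_of_van (x y : {ffun 'I_k -> PRing F}) (i : 'I_r) :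
    vanishes_at i x != vanishes_at i y -> x != y.
  by apply: contraNneq => ->.
pose e l : PRing F := [ffun i => (i == l)%:R].
pose i1 : 'I_r := Ordinal (ltnW r_gt1); pose i2 : 'I_r := Ordinal r_gt1.
have van_01 : vanishes_at i1 (cw (pzero F)) != vanishes_at i1 (cw (e i1)).
  by rewrite !van_cw !ffunE eqxx oner_eq0.
have van_02 : vanishes_at i2 (cw (pzero F)) != vanishes_at i2 (cw (e i2)).
  by rewrite !van_cw !ffunE eqxx oner_eq0.
have van_12 : vanishes_at i1 (cw (e i1)) != vanishes_at i1 (cw (e i2)).
  by rewrite !van_cw !ffunE eqxx oner_eq0 (_ : i1 == i2 = false) ?eqxx.
rewrite -card_windows.
have [z_in | z_out] := boolP (cw (pzero F) \in codom f).
  move: (out_of_codom _ _ _ van_01) (out_of_codom _ _ _ van_02); rewrite z_in /=.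
  exact: card_codom_le_subn2 f_inj (neq_of_van _ _ _ van_12).
have [w1_in | w1_out] := boolP (cw (e i1) \in codom f); last first.
  exact: card_codom_le_subn2 f_inj (neq_of_van _ _ _ van_01) z_out w1_out.
move: (out_of_codom _ _ _ van_12); rewrite w1_in /= => w2_out.
exact: card_codom_le_subn2 f_inj (neq_of_van _ _ _ van_02) z_out w2_out.
Qed.

Section ComponentwiseSequences.
Variables (r : nat) (F : 'I_r -> finFieldType) (k : nat) (b c : forall i, nat -> F i).

Lemma lin_rec_ffun :
  (forall i, c i 0%N != 0) ->
  (forall i n, b i (n + k)%N = \sum_(j < k) c i j * b i (n + j)%N) ->
  lin_rec k (fun j => [ffun i => c i j]) (fun n => [ffun i => b i n]).
Proof.
move=> c0 b_rec; split.
  by exists [ffun i => (c i 0%N)^-1]; apply/ffunP => i; rewrite !ffunE divff ?c0.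
move=> n; apply/ffunP => i; rewrite padd_bigE ffunE b_rec.
by apply: eq_bigr => j _; rewrite !ffunE.
Qed.

Lemma is_period_ffun m :
  is_period (fun n => [ffun i => b i n]) m <-> forall i n, b i (n + m)%N = b i n.
Proof.
split=> [b_per i n | b_per n]; last by apply/ffunP => i; rewrite !ffunE b_per.
by move/ffunP/(_ i): (b_per n); rewrite !ffunE.
Qed.

End ComponentwiseSequences.

Lemma card_PRing1 (F : 'I_1 -> finFieldType) : #|PRing F| = #|F ord0|.
Proof. by rewrite card_dep_ffun /image_mem enum_ordSl enum_ord0 /= muln1. Qed.

Theorem theorem4p6 (r : nat) (F : 'I_r -> finFieldType) (k : nat)
  (hr : (1 <= r)%N) (hk : (1 <= k)%N) :
  (exists a : nat -> PRing F,
      satisfies_lrec_deg k a /\ least_period a (#|PRing F| ^ k - 1)%N)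
  <-> r = 1%N.
Proof.
split=> [[a [[c a_rec] a_least]] | r1].
  apply/eqP; rewrite eqn_leq hr andbT leqNgt; apply/negP => r_gt1.
  have := lin_rec_least_period_le r_gt1 hk a_rec a_least.
  by case: a_least; lia.
subst r; have [b /fin_all_exists[c bc]] :=
  fin_all_exists (fun i => finField_rec_period_exists (F i) hk).
exists (fun n => [ffun i => b i n]); split.
  exists (fun j => [ffun i => c i j]).
  by apply: lin_rec_ffun => i; have [c0 b_rec _] := bc i.
have periodE m : is_period (fun n => [ffun i => b i n]) m <-> (#|F ord0| ^ k - 1 %| m)%N.
  rewrite is_period_ffun; have [_ _ b_per] := bc ord0.
  by split=> [/(_ ord0)/b_per | /b_per b0_per i]; last rewrite (ord1 i).
rewrite card_PRing1; split; first by rewrite subn_gt0 (ltn_exp2l 0) // finNzRing_gt1.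
split=> [|m m_gt0 /periodE]; first exact/periodE.
exact: dvdn_leq.
Qed.
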